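(* Let $\alpha>0$ be constant, $a<b<c<d$, and let $U$ and $V$ be the DGSEM approximations on the base domain $\Omega_u=[a,c]$ and the overset domain $\Omega_v=[b,d]$ of the scalar overset grid problem for $\omega_t+\alpha\omega_x=0$, as defined in the context. For fixed polynomial order $N$, fixed mesh and fixed time $T$, the total energy is bounded by the initial data: there is a constant $K$, depending on $N$, the mesh, $T$ and $\alpha$ but not on the initial data, such that $$\|U(T)\|^2_{\Omega_u}+\|V(T)\|^2_{\Omega_v}\le K\left(\|\omega_0\|^2_{\Omega_u}+\|\omega_0\|^2_{\Omega_v}\right).$$
   Context: Continuous problem: $u_t+\alpha u_x=0$ on $\Omega_u=[a,c]$ with $u(a,t)=0$, and $v_t+\alpha v_x=0$ on $\Omega_v=[b,d]$ with $v(b,t)=u(b,t)$, both with initial condition $\omega_0$. Meshes: $\Omega_u$ is divided into $K_u$ consecutive elements of equal size $\Delta x$, and $\Omega_v$ into $K_v$ consecutive elements of equal size. Each element $[x_{k-1},x_k]$ is mapped affinely from $\xi\in[-1,1]$ by $x=x_{k-1}+\frac{\xi+1}{2}(x_k-x_{k-1})$. Discretization: on each element the solution is a polynomial of degree $\le N$ ($N\ge1$) in $\xi$ with time dependent coefficients. Let $\xi_j,w_j$, $j=0,\dots,N$, be the Legendre-Gauss-Lobatto (LGL) nodes (including $\pm1$) and weights on $[-1,1]$, and $\langle f,g\rangle_N=\sum_{j=0}^N f(\xi_j)g(\xi_j)w_j$. The upwind flux is $F^*(U^L,U^R)=\alpha U^L$, where $U^L,U^R$ are the states to the left and right of an element boundary.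 On each base element, $U$ satisfies, for all polynomials $\phi$ of degree $\le N$, $$\tfrac{\Delta x}{2}\langle U_t,\phi\rangle_N+\phi F^*\big|_{-1}^{1}-\alpha\langle U,\phi_\xi\rangle_N=0,$$ with external left state $0$ at $x=a$. On each overset element, $V$ satisfies the same equation (with the overset element size in place of $\Delta x$), with external left state at $x=b$ equal to $U(b,t)$, the value at $b$ of the polynomial in the base element that contains $b$. At interior element interfaces the left and right states are the traces from the two neighbouring elements. Initial data and norms: $U(\cdot,0)$ and $V(\cdot,0)$ are the elementwise polynomial interpolants of $\omega_0$ at the LGL nodes. $\|\cdot\|_{\Omega_u}$ and $\|\cdot\|_{\Omega_v}$ are the $L^2$ norms over $\Omega_u$ and $\Omega_v$; the symbols $\|\omega_0\|_{\Omega_u}$, $\|\omega_0\|_{\Omega_v}$ stand for $\|U(\cdot,0)\|_{\Omega_u}$, $\|V(\cdot,0)\|_{\Omega_v}$. *)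

(* Defs.v *)
From mathcomp Require Import all_boot all_order all_algebra.
From mathcomp Require Import all_classical all_reals all_analysis.
Set Implicit Arguments.
Unset Strict Implicit.
Unset Printing Implicit Defensive.
Import Order.TTheory GRing.Theory Num.Theory.
Import numFieldNormedType.Exports.
Local Open Scope classical_set_scope.
Local Open Scope ring_scope.

(* Rodrigues' formula. *)
Definition legendre (R : realType) (n : nat) : {poly R} :=
  ((2%:R ^+ n * n`!%:R)^-1) *: derivn n (('X^2 - 1) ^+ n).

Definition lagrange_basis (R : realType) (n : nat) (xi : 'I_n -> R)
    (j : 'I_n) : {poly R} :=
  \prod_(i < n | i != j) ((xi j - xi i)^-1 *: ('X - (xi i)%:P)).

(* (1 - X^2) L_N' has degree N + 1, so N + 1 increasing roots are all of its
   roots; the quadrature is interpolatory. *)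
Definition is_LGL (R : realType) (N : nat) (xi w : 'I_N.+1 -> R) : Prop :=
  [/\ {homo xi : i j / (i < j)%N >-> i < j},
      forall j, root ((1 - 'X^2) * deriv (legendre R N)) (xi j) &
      forall j, w j = \int[@lebesgue_measure R]_(x in `[-1, 1])
                        (lagrange_basis xi j).[x]].

Definition lgl_ip (R : realType) (N : nat) (xi w : 'I_N.+1 -> R)
    (f g : {poly R}) : R :=
  \sum_(j < N.+1) f.[xi j] * g.[xi j] * w j.

Definition mesh_size (R : realType) (lo hi : R) (K : nat) : R :=
  (hi - lo) / K%:R.

Definition mesh_node (R : realType) (lo hi : R) (K k : nat) : R :=
  lo + k%:R * mesh_size lo hi K.

Definition elem_map (R : realType) (lo hi : R) (K k : nat) (xi : R) : R :=
  mesh_node lo hi K k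
  + (xi + 1) / 2 * (mesh_node lo hi K k.+1 - mesh_node lo hi K k).

(* Inverse of [elem_map lo hi K k]. *)
Definition ref_coord (R : realType) (lo hi : R) (K k : nat) (x : R) : R :=
  2 * (x - mesh_node lo hi K k)
    / (mesh_node lo hi K k.+1 - mesh_node lo hi K k) - 1.

(* The function of the physical variable given by element polynomials [W] in
   the reference variable. At an interior interface it takes the trace from the
   right, and at [hi] and outside [lo, hi] it vanishes. These choices do not
   affect L^2 norms, the only use made of it. *)
Definition dg_fun (R : realType) (lo hi : R) (K : nat) (W : 'I_K -> {poly R})
    (x : R) : R :=
  \sum_(k < K) (W k).[ref_coord lo hi K k x]
    * \1_`[mesh_node lo hi K k, mesh_node lo hi K k.+1[ x.

Definition L2norm (R : realType) (lo hi : R) (f : R -> R) : R :=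
  Num.sqrt (\int[@lebesgue_measure R]_(x in `[lo, hi]) (f x ^+ 2)).

Definition upwind_flux (R : realType) (alpha UL UR : R) : R := alpha * UL.

Definition left_state (R : realType) (K : nat) (ext : R) (W : 'I_K -> {poly R})
    (k : 'I_K) : R :=
  if k == 0%N :> nat then ext else (W (ord_pred k)).[1].

(* No state is prescribed to the right of the last element, and the upwind flux
   does not depend on it: the interior trace is used there. *)
Definition right_state (R : realType) (K : nat) (W : 'I_K -> {poly R})
    (k : 'I_K) : R :=
  if k.+1 == K then (W k).[1] else (W (ordS k)).[-1].

Definition poly_dt (R : realType) (N : nat) (P : R -> {poly R}) (t : R) :
    {poly R} :=
  \poly_(i < N.+1) derive1 (fun s => (P s)`_i) t.

Definition dg_residual (R : realType) (N : nat) (xi w : 'I_N.+1 -> R)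
    (alpha h : R) (K : nat) (ext : R -> R) (W : R -> 'I_K -> {poly R})
    (t : R) (k : 'I_K) (phi : {poly R}) : R :=
  h / 2 * lgl_ip xi w (poly_dt N (fun s => W s k) t) phi
  + (phi.[1] * upwind_flux alpha (W t k).[1] (right_state (W t) k)
     - phi.[-1] * upwind_flux alpha (left_state (ext t) (W t) k) (W t k).[-1])
  - alpha * lgl_ip xi w (W t k) (deriv phi).

(* [ext] is the external state to the left of [lo]. *)
Definition dgsem_solution (R : realType) (N : nat) (xi w : 'I_N.+1 -> R)
    (alpha lo hi T : R) (K : nat) (ext omega0 : R -> R)
    (W : R -> 'I_K -> {poly R}) : Prop :=
  [/\ forall t k, t \in `[0, T] -> (size (W t k) <= N.+1)%N,
      forall k i, {within `[0, T], continuous (fun t => (W t k)`_i)},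
      forall t k i, t \in `]0, T[ -> derivable (fun s => (W s k)`_i) t 1,
      forall t k (phi : {poly R}), t \in `]0, T[ -> (size phi <= N.+1)%N ->
        dg_residual xi w alpha (mesh_size lo hi K) ext W t k phi = 0 &
      forall k j, (W 0 k).[xi j] = omega0 (elem_map lo hi K k (xi j))].

Definition overset_solution (R : realType) (N : nat) (xi w : 'I_N.+1 -> R)
    (alpha a b c d T : R) (Ku Kv : nat) (kb : 'I_Ku) (omega0 : R -> R)
    (U : R -> 'I_Ku -> {poly R}) (V : R -> 'I_Kv -> {poly R}) : Prop :=
  dgsem_solution xi w alpha a c T (fun=> 0) omega0 U /\
  dgsem_solution xi w alpha b d T
    (fun t => (U t kb).[ref_coord a c Ku kb b]) omega0 V.

(* Main.v *)
(* The mesh and the polynomial order being fixed, both schemes are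
   finite-dimensional linear systems of ODEs for the polynomial coefficients:
   testing the weak form with the Lagrange basis at the LGL nodes isolates the
   time derivative at each node, up to the factor [h w_j / 2], so positivity of
   the LGL weights bounds every coefficient derivative by the coefficients of
   both grids. Gronwall's inequality then controls the sum of the squared
   coefficients at time [T] by its initial value, and this sum is equivalent to
   the total L^2 energy because the Gram matrix of the monomials is
   invertible. *)
From HB Require Import structures.
Require Import Defs.
From mathcomp Require Import all_boot all_order all_algebra.
From mathcomp Require Import all_classical all_reals all_analysis.
From mathcomp Require Import ring lra.
Import Order.TTheory GRing.Theory Num.Theory.
Import numFieldNormedType.Exports.
Local Open Scope classical_set_scope.
Local Open Scope ring_scope.
Set Implicit Arguments.
Unset Strict Implicit.
Unset Printing Implicit Defensive.

(** * Integration of polynomials over the reference element *)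

Lemma integrable_horner (R : realType) (u v : R) (p : {poly R}) :
  (@lebesgue_measure R).-integrable `[u, v] (EFin \o horner p).
Proof.
apply: continuous_compact_integrable; first exact: segment_compact.
exact/continuous_subspaceT/continuous_horner.
Qed.

Lemma Rintegral_deriv (R : realType) (u v : R) (P : {poly R}) : u <= v ->
  \int[@lebesgue_measure R]_(x in `[u, v]) (P^`()).[x] = P.[v] - P.[u].
Proof.
rewrite le_eqVlt => /predU1P[<-|uv].
  by rewrite set_itv1 Rintegral_set1 subrr.
rewrite /Rintegral (@continuous_FTC2 _ _ (horner P)) //.
- exact/continuous_subspaceT/continuous_horner.
- split=> [x _||]; first exact: derivable_horner.
  + by apply: cvg_at_right_filter; exact: continuous_horner.
  + by apply: cvg_at_left_filter; exact: continuous_horner.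
- by move=> x _; rewrite derivE.
Qed.

(** Through such a primitive an integral becomes a difference of endpoint values, so that linearity
    of [ref_int] is pure algebra. *)
Lemma poly_antideriv (R : realType) (p : {poly R}) : exists P, p = P^`().
Proof.
elim/poly_ind: p => [|p c _]; first by exists 0; rewrite deriv0.
set q := _ + _.
(* At [i = 0] the entry is a division by zero, hence [0]. *)
exists (\poly_(i < (size q).+1) (q`_i.-1 / i%:R)).
apply/polyP => i; rewrite coef_deriv coef_poly ltnS.
case: ltnP => [_|qi] /=; last by rewrite mul0rn nth_default.
by rewrite -(mulr_natr (_ / _)) mulfVK // pnatr_eq0.
Qed.

Definition ref_int (R : realType) (p : {poly R}) : R :=
  \int[@lebesgue_measure R]_(x in `[-1, 1]) p.[x].

Lemma ref_int_deriv (R : realType) (P : {poly R}) :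
  ref_int P^`() = P.[1] - P.[-1].
Proof. by rewrite /ref_int Rintegral_deriv //; lra. Qed.

Lemma ref_int_is_linear (R : realType) : linear_for *%R (@ref_int R).
Proof.
move=> a p q.
have [P ->] := poly_antideriv p; have [Q ->] := poly_antideriv q.
by rewrite -derivZ -derivD !ref_int_deriv !(hornerD, hornerZ) /=; ring.
Qed.

HB.instance Definition _ (R : realType) :=
  GRing.isLinear.Build R {poly R} R *%R (@ref_int R) (@ref_int_is_linear R).

Lemma ref_int_ge0 (R : realType) (p : {poly R}) :
  (forall x, -1 <= x <= 1 -> 0 <= p.[x]) -> 0 <= ref_int p.
Proof. by move=> p0; apply: Rintegral_ge0 => x /=; rewrite in_itv; exact: p0. Qed.

Lemma ref_int_sqr_ge0 (R : realType) (p : {poly R}) : 0 <= ref_int (p * p).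
Proof. by apply: ref_int_ge0 => x _; rewrite hornerM -expr2 sqr_ge0. Qed.

Lemma poly_itv_const (R : realType) (P : {poly R}) (c : R) :
  (forall x, -1 <= x <= 1 -> P.[x] = c) -> P^`() = 0.
Proof.
move=> Pc; suff -> : P = c%:P by rewrite derivC.
apply/eqP; rewrite -subr_eq0; apply/eqP.
(* The reciprocals of 1, 2, ... are distinct points of [-1, 1]; as many of them as the size of
   [P - c%:P] force this polynomial to vanish. *)
pose s := [seq (i.+1%:R)^-1 : R | i <- iota 0 (size (P - c%:P))].
apply: (@roots_geq_poly_eq0 _ _ s).
- apply/allP => _ /mapP[i _ ->]; rewrite rootE !hornerE Pc ?subrr //.
  rewrite (le_trans (_ : -1 <= 0)) ?invr_ge0 ?ler0n ?lerN10 //=.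
  by rewrite invf_le1 ?ltr0n // ler1n.
- rewrite map_inj_uniq ?iota_uniq // => i j /invr_inj/eqP.
  by rewrite eqr_nat eqSS => /eqP.
- by rewrite size_map size_iota.
Qed.

(** A primitive of [p * p] is nondecreasing; a zero integral makes its values at -1 and 1 equal, so
    it is constant on [-1, 1] and its derivative vanishes. *)
Lemma ref_int_sqr_eq0 (R : realType) (p : {poly R}) :
  (ref_int (p * p) == 0) = (p == 0).
Proof.
apply/eqP/eqP => [|->]; last by rewrite mul0r linear0.
have [P pP] := poly_antideriv (p * p).
have mono u v : u <= v -> P.[u] <= P.[v].
  move=> uv; rewrite -subr_ge0 -Rintegral_deriv // -pP.
  by apply: Rintegral_ge0 => x _; rewrite hornerM -expr2 sqr_ge0.
rewrite pP ref_int_deriv => /subr0_eq P11.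
have P0 : P^`() = 0.
  apply: (@poly_itv_const _ _ P.[1]) => x /andP[x1 x2].
  by apply/le_anti; rewrite mono //= P11 mono.
by move/eqP: P0; rewrite -pP mulf_eq0 orbb => /eqP.
Qed.

Lemma ref_int_sqr_gt0 (R : realType) (p : {poly R}) :
  p != 0 -> 0 < ref_int (p * p).
Proof. by move=> p0; rewrite lt0r ref_int_sqr_eq0 p0 ref_int_sqr_ge0. Qed.

Lemma ref_int_cauchy_schwarz (R : realType) (p q : {poly R}) :
  ref_int (p * q) ^+ 2 <= ref_int (p * p) * ref_int (q * q).
Proof.
have [->|q0] := eqVneq q 0; first by rewrite !mulr0 linear0 expr0n mulr0.
have qq := ref_int_sqr_gt0 q0.
(* These weights avoid a division: expanding the square gives C (A C - B^2) >= 0, and C > 0. *)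
have := ref_int_sqr_ge0 (ref_int (q * q) *: p - ref_int (p * q) *: q).
set A := ref_int (p * p); set B := ref_int (p * q); set C := ref_int (q * q).
have -> : (C *: p - B *: q) * (C *: p - B *: q) =
    C ^+ 2 *: (p * p) - (2 * B * C) *: (p * q) + B ^+ 2 *: (q * q).
  by rewrite -!mul_polyC !polyC_exp !polyCM polyC_natr; ring.
rewrite linearD linearB !linearZ /= -/A -/B -/C => h.
rewrite -subr_ge0 -(pmulr_rge0 _ qq) -/C.
suff -> : C * (A * C - B ^+ 2) = C ^+ 2 * A + (2 * B * C) *: - B + B ^+ 2 * C by [].
by rewrite /GRing.scale /=; ring.
Qed.

(** * Legendre polynomials *)

Lemma coefM_top (R : nzRingType) (p q : {poly R}) (m n : nat) :
  (size p <= m.+1)%N -> (size q <= n.+1)%N -> (p * q)`_(m + n) = p`_m * q`_n.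
Proof.
move=> sp sq; have mP : (m < (m + n).+1)%N by rewrite ltnS leq_addr.
rewrite coefM (bigD1 (Ordinal mP)) //= addKn big1 ?addr0 // => i im.
case: (ltngtP i m) => [ltim|ltmi|eim]; last by case/eqP: im; exact: val_inj.
- by rewrite [q`__]nth_default ?mulr0 // (leq_trans sq) // ltn_subRL ltn_add2r.
- by rewrite [p`__]nth_default ?mul0r // (leq_trans sp).
Qed.

Lemma ref_int_by_parts (R : realType) (p q : {poly R}) :
  ref_int (p * q^`()) =
  p.[1] * q.[1] - p.[-1] * q.[-1] - ref_int (p^`() * q).
Proof.
by rewrite -!hornerM -ref_int_deriv derivM linearD /= addrAC subrr add0r.
Qed.

(** Each differentiation lowers the order of a zero by at most one. *)
Lemma root_derivn_XsubC_exp (R : comNzRingType) (c : R) (f : {poly R})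
    (n m : nat) :
  (m < n)%N -> root (('X - c%:P) ^+ n * f)^`(m) c.
Proof.
suff E k : exists g,
    (('X - c%:P) ^+ (k + m) * f)^`(m) = ('X - c%:P) ^+ k * g.
  move=> mn; have := E (n - m)%N; rewrite subnK ?(ltnW mn) // => -[h ->].
  by rewrite rootE !hornerE subrr expr0n subn_eq0 leqNgt mn mul0r.
elim: m k => [|m IH] k; first by exists f; rewrite addn0.
have [g gE] := IH k.+1; rewrite derivnS -addSnnS gE.
exists ((k.+1)%:R *: g + ('X - c%:P) * g^`()).
rewrite derivM deriv_exp /= derivXsubC mul1r -scaler_nat exprS -!mul_polyC.
by ring.
Qed.

Section Legendre.
Variables (R : realType) (N : nat).
Let L := legendre R N.

Let X2B1_monic : ('X^2 - 1 : {poly R}) ^+ N \is monic.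
Proof.
by apply/monic_exp; rewrite -[1]/(1%:P) monicXnsubC.
Qed.

Let size_X2B1 : size (('X^2 - 1 : {poly R}) ^+ N) = (2 * N).+1.
Proof.
have := size_exp (('X^2 - 1) : {poly R}) N.
by rewrite size_Xn_sub_1 // => <-; rewrite prednK ?size_poly_gt0 ?monic_neq0.
Qed.

Lemma size_legendre_leq : (size L <= N.+1)%N.
Proof.
rewrite (leq_trans (size_scale_leq _ _)) //; apply/leq_sizeP => j Nj.
rewrite coef_derivn nth_default ?mul0rn //.
by rewrite size_X2B1 mul2n -addnn -addnS leq_add2l.
Qed.

Lemma coef_legendre_neq0 : L`_N != 0.
Proof.
rewrite coefZ; apply: mulf_neq0.
  by rewrite invr_neq0 // mulf_neq0 ?expf_neq0 ?pnatr_eq0 -?lt0n ?fact_gt0.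
have := X2B1_monic; rewrite monicE lead_coefE size_X2B1 /= mul2n -addnn coef_derivn.
by move/eqP ->; rewrite pnatr_eq0 -lt0n ffact_gt0 leq_addr.
Qed.

(** Rodrigues' formula is integrated by parts repeatedly: boundary terms vanish because 1 and -1 are
    zeros of order [N] of (X^2 - 1)^N, and [p] is eventually differentiated to zero. *)
Lemma legendre_orth (p : {poly R}) : (size p <= N)%N -> ref_int (p * L) = 0.
Proof.
rewrite /L /legendre -scalerAr linearZ /= => sp.
set f := ('X^2 - 1) ^+ N; suff -> : ref_int (p * f^`(N)) = 0 by rewrite mulr0.
have rtf m (e : R) : e ^+ 2 = 1 -> (m < N)%N -> root f^`(m) e.
  move=> e2 mN; suff -> : f = ('X - e%:P) ^+ N * ('X + e%:P) ^+ N.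
    exact: root_derivn_XsubC_exp.
  by rewrite -exprMn /f -[1]/(1%:P) -e2 polyC_exp; congr (_ ^+ _); ring.
(* Induction on the number [m] of derivatives on [f], with [p] of size at most [m]; at [m = 0] only
   [p = 0] remains. *)
elim: {-2}N (leqnn N) p sp => [_ p|m IH mN p sp].
  by rewrite leqn0 size_poly_eq0 => /eqP ->; rewrite mul0r linear0.
rewrite derivnS ref_int_by_parts !(rootP (rtf _ _ _ mN)) ?expr1n ?sqrrN ?expr1n //.
rewrite !mulr0 subrr sub0r IH ?oppr0 ?(ltnW mN) //.
have [->|p0] := eqVneq p 0; first by rewrite deriv0 size_poly0.
by rewrite -ltnS (leq_trans (lt_size_deriv p0)).
Qed.

(** The combination L_N p - p_N L has no term of degree N, hence is orthogonal to L. *)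
Lemma ref_int_legendre_top (p : {poly R}) : (size p <= N.+1)%N ->
  L`_N * ref_int (p * L) = p`_N * ref_int (L * L).
Proof.
move=> sp; apply/eqP; rewrite -subr_eq0; apply/eqP.
rewrite -[X in X = _](_ : ref_int ((L`_N *: p - p`_N *: L) * L) = _); last first.
  by rewrite mulrBl -!scalerAl linearB !linearZ.
apply: legendre_orth; apply/leq_sizeP => j.
rewrite coefB (coefZ L`_N) (coefZ p`_N) leq_eqVlt => /predU1P[<-|Nj].
  by rewrite mulrC subrr.
rewrite (nth_default _ (leq_trans size_legendre_leq Nj)).
by rewrite (nth_default _ (leq_trans sp Nj)) !mulr0 subrr.
Qed.

(* The LGL nodes are the roots of [(1 - X^2) L_N'], which integration by parts
   shows to be orthogonal to all polynomials of degree at most N - 2. *)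
Lemma ref_int_lobatto (q : {poly R}) : (0 < N)%N -> (size q <= N)%N ->
  L`_N * ref_int (q * ((1 - 'X^2) * L^`())) =
  N.+1%:R * q`_N.-1 * ref_int (L * L).
Proof.
move=> N0 sq; rewrite mulrA ref_int_by_parts.
(* The factor 1 - X^2 removes both boundary terms. *)
have -> : (q * (1 - 'X^2)).[1] = 0 by rewrite !hornerE; ring.
have -> : (q * (1 - 'X^2)).[-1] = 0 by rewrite !hornerE; ring.
rewrite !mul0r subrr sub0r mulrN.
have s1 : (size (q * (1 - 'X^2))%R <= N.+2)%N.
  rewrite (leq_trans (size_polyMleq _ _)) // -[(1 - _)]opprB size_polyN.
  by rewrite size_Xn_sub_1 // addn3 /= !ltnS.
rewrite ref_int_legendre_top; last first.
  have [->|p0] := eqVneq (q * (1 - 'X^2)) 0; first by rewrite deriv0 size_poly0.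
  by rewrite -ltnS (leq_trans (lt_size_deriv p0)).
(* The top coefficient of q (1 - X^2), in degree N + 1, is minus that of [q]; this sign cancels the
   one from integration by parts. *)
rewrite coef_deriv mulrBr mulr1 coefB coefMXn ltnS ltnNge N0 /= subSS subn1.
by rewrite nth_default ?(leq_trans sq) // sub0r -mulr_natr; ring.
Qed.

Lemma size_lobatto : (0 < N)%N -> (size ((1 - 'X^2) * L^`())%R <= N.+2)%N.
Proof.
move=> N0; have -> : (1 - 'X^2) * L^`() = L^`() - L^`() * 'X^2 by ring.
apply/leq_sizeP => -[|[|j]] // Nj; rewrite coefB coefMXn /= !coef_deriv !subSS subn0.
have Lk k : (N <= k)%N -> L`_k.+1 = 0.
  by move=> Nk; rewrite nth_default // (leq_trans size_legendre_leq).
have {}Nj : (N <= j)%N by [].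
by rewrite !Lk ?mul0rn ?subrr // !leqW.
Qed.

Lemma coef_lobatto : (0 < N)%N ->
  ((1 - 'X^2) * L^`())`_N.+1 = - (N%:R * L`_N).
Proof.
move=> N0; have -> : (1 - 'X^2) * L^`() = L^`() - L^`() * 'X^2 by ring.
rewrite coefB coefMXn ltnS ltnNge N0 /= !coef_deriv subSS subn1 prednK //.
rewrite nth_default ?(leq_trans size_legendre_leq) // mul0rn sub0r.
by rewrite mulr_natl.
Qed.

End Legendre.

(** * Positivity of the Legendre-Gauss-Lobatto weights *)

Section Lagrange.
Variables (R : realType) (n : nat) (xi : 'I_n -> R).
Hypothesis xi_inj : injective xi.

Lemma horner_lagrange_basis (i j : 'I_n) :
  (lagrange_basis xi j).[xi i] = (i == j)%:R.
Proof.
rewrite /lagrange_basis horner_prod; have [->|ij] := eqVneq i j.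
  rewrite big1 // => k kj; rewrite !hornerE mulVf // subr_eq0.
  by rewrite (inj_eq xi_inj) eq_sym.
by rewrite (bigD1 i) //= !hornerE subrr mulr0 mul0r.
Qed.

Lemma size_lagrange_basis (j : 'I_n) : (size (lagrange_basis xi j) <= n)%N.
Proof.
apply: leq_trans (size_poly_prod_leq _ _) _.
apply: (@leq_trans ((\sum_(i < n | i != j) 2).+1 - #|[pred i | i != j]|))%N.
  rewrite leq_sub2r // ltnS leq_sum // => i _.
  by rewrite (leq_trans (size_scale_leq _ _)) // size_XsubC.
rewrite sum_nat_const; set m := #|_|.
have -> : m = n.-1 by rewrite /m cardC1 card_ord.
by move: {m} j; case: n xi => [_ []//|k _ _] /=; rewrite muln2 -addnn -addnS addKn.
Qed.

(** The difference of both sides has size at most [n] and vanishes at [n] distinct nodes. *)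
Lemma lagrange_interpolation (p : {poly R}) : (size p <= n)%N ->
  p = \sum_(j < n) p.[xi j] *: lagrange_basis xi j.
Proof.
move=> sp; apply/eqP; rewrite -subr_eq0; apply/eqP.
apply: (@roots_geq_poly_eq0 _ _ [seq xi i | i <- enum 'I_n]).
- apply/allP => _ /mapP[i _ ->]; rewrite rootE hornerD hornerN horner_sum.
  rewrite (bigD1 i) //= hornerZ horner_lagrange_basis eqxx mulr1.
  rewrite big1 ?addr0 ?subrr // => k ki.
  by rewrite hornerZ horner_lagrange_basis eq_sym (negPf ki) mulr0.
- by rewrite map_inj_uniq ?enum_uniq.
- rewrite size_map size_enum_ord (leq_trans (size_polyD _ _)) // size_polyN.
  rewrite geq_max sp (leq_trans (size_sum _ _ _)) //.
  apply/bigmax_leqP => i _.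
  by rewrite (leq_trans (size_scale_leq _ _)) // size_lagrange_basis.
Qed.

End Lagrange.

Lemma LGL_injective (R : realType) (N : nat) (xi w : 'I_N.+1 -> R) :
  is_LGL xi w -> injective xi.
Proof.
case=> mono _ _ i j; case: (ltngtP i j) => [/mono|/mono|/val_inj //].
- by move=> + e; rewrite e ltxx.
- by move=> + e; rewrite e ltxx.
Qed.

(* With [l] the j-th basis polynomial, [l^2 - l] vanishes at the nodes, hence
   equals [q (1 - X^2) L_N']. Its integral, governed by the coefficient of
   degree N - 1 of [q], is nonpositive, so [w_j] is at least the integral of
   [l^2]. *)
Lemma LGL_weight_gt0 (R : realType) (N : nat) (xi w : 'I_N.+1 -> R)
    (j : 'I_N.+1) : (0 < N)%N -> is_LGL xi w -> 0 < w j.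
Proof.
move=> N0 lgl; have inj := LGL_injective lgl; case: lgl => _ rt ->.
set l := lagrange_basis xi j; rewrite -/(ref_int l).
set Q := (1 - 'X^2) * (legendre R N)^`() in rt.
set k := (legendre R N)`_N; have k0 : k != 0 by exact: coef_legendre_neq0.
have n0 : N%:R != 0 :> R by rewrite pnatr_eq0 -lt0n.
have QN : Q`_N.+1 = - (N%:R * k) by exact: coef_lobatto.
have QN0 : Q`_N.+1 != 0 by rewrite QN oppr_eq0 mulf_neq0.
have sQ : size Q = N.+2.
  apply/eqP; rewrite eqn_leq size_lobatto //= ltnNge.
  by apply: contra QN0 => sQ; rewrite nth_default.
pose rs := [seq xi i | i <- enum 'I_N.+1].
have urs : uniq_roots rs by rewrite uniq_rootsE map_inj_uniq ?enum_uniq.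
(* Having size [N.+2] and the [N.+1] distinct nodes as roots, [Q] splits completely; vanishing at
   the nodes thus means divisibility by [Q]. *)
have QE : Q = lead_coef Q *: \prod_(z <- rs) ('X - z%:P).
  apply: all_roots_prod_XsubC => //; first by rewrite size_map size_enum_ord.
  by apply/allP => _ /mapP[i _ ->]; exact: rt.
have l0 : l != 0.
  apply/eqP => l0; have := horner_lagrange_basis inj j j.
  by rewrite -/l l0 horner0 eqxx => /esym/eqP; rewrite oner_eq0.
have sl : (size l <= N.+1)%N by exact: size_lagrange_basis.
have sll : (size (l * l - l)%R <= (N + N).+1)%N.
  rewrite (leq_trans (size_polyD _ _)) // size_polyN geq_max; apply/andP; split.
    rewrite (leq_trans (size_polyMleq _ _)) // -ltnS.
    by rewrite prednK ?addn_gt0 ?size_poly_gt0 ?l0 //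
      (leq_trans (leq_add sl sl)) // addnS addSn.
  by rewrite (leq_trans sl) // ltnS leq_addr.
have /dvdpP[q qE] : Q %| l * l - l.
  rewrite QE dvdpZl ?lead_coef_eq0 -?size_poly_gt0 ?sQ //.
  apply: uniq_roots_dvdp => //; apply/allP => _ /mapP[i _ ->].
  rewrite rootE !hornerE (horner_lagrange_basis inj).
  by case: (i == j); rewrite ?mulr1 ?mulr0 subrr.
have sq : (size q <= N)%N.
  have [->|q0] := eqVneq q 0; first by rewrite size_poly0.
  have Q0 : Q != 0 by rewrite -size_poly_gt0 sQ.
  by move: sll; rewrite qE size_mul // sQ !addnS /= ltnS addnC leq_add2l.
(* Coefficients of degree 2N in l^2 - l = q Q are compared; [l], of degree at most N < 2N,
   contributes only through its square. *)
have qN : q`_N.-1 * Q`_N.+1 = l`_N ^+ 2.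
  rewrite -(@coefM_top _ q Q N.-1 N.+1) ?prednK ?sQ // -qE.
  have -> : (N.-1 + N.+1 = N + N)%N by rewrite addnS -addSn prednK.
  rewrite coefB (@coefM_top _ l l N N) // [X in _ - X]nth_default ?subr0 //.
  by rewrite (leq_trans sl) // -addn1 leq_add2l.
have LL := ref_int_sqr_ge0 (legendre R N).
have := ref_int_lobatto N0 sq; rewrite -/Q -qE -/k linearB /= => I.
(* Multiplying by the leading coefficient -N k of [Q] makes the right side nonnegative, while the
   factor -N k^2 on the left is negative whatever the sign of [k]. *)
have : k * (- (N%:R * k)) * (ref_int (l * l) - ref_int l) =
    N.+1%:R * l`_N ^+ 2 * ref_int (legendre R N * legendre R N).
  by rewrite mulrAC I -qN QN; ring.
have ll := ref_int_sqr_gt0 l0 => E.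
apply: lt_le_trans ll _; rewrite -subr_le0.
have k2 : 0 < N%:R * k ^+ 2 by rewrite mulr_gt0 ?ltr0n // exprn_even_gt0.
rewrite -(pmulr_rle0 _ k2) -oppr_ge0.
have -> : - (N%:R * k ^+ 2 * (ref_int (l * l) - ref_int l)) =
   k * (- (N%:R * k)) * (ref_int (l * l) - ref_int l) by ring.
by rewrite E mulr_ge0 // mulr_ge0 ?sqr_ge0 ?ler0n.
Qed.

(** * Coefficients versus the integral of the square *)

Lemma sqr_sum_le (R : realFieldType) (I : finType) (x : I -> R) :
  (\sum_i x i) ^+ 2 <= #|I|%:R * \sum_i x i ^+ 2.
Proof.
rewrite expr2 big_distrlr /=.
(* The inequality 2 x y <= x^2 + y^2 is applied to each term of the double sum. *)
apply: (@le_trans _ _ (\sum_i \sum_j (x i ^+ 2 / 2 + x j ^+ 2 / 2))).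
  apply: ler_sum => i _; apply: ler_sum => j _.
  by have := sqr_ge0 (x i - x j); nra.
suff -> : \sum_i \sum_j (x i ^+ 2 / 2 + x j ^+ 2 / 2) =
    #|I|%:R * \sum_i x i ^+ 2 by [].
rewrite (eq_bigr (fun i => #|I|%:R * (x i ^+ 2 / 2) + (\sum_j x j ^+ 2) / 2)).
  rewrite big_split /= sumr_const -mulr_sumr -mulr_suml -(mulr_natl (_ / _)).
  by rewrite -mulrDr -splitr.
by move=> i _; rewrite big_split /= sumr_const -mulr_suml -(mulr_natl (_ / _)).
Qed.

(** The factor in [x] is separated from the coefficients so that, at a fixed node, a constant can
    absorb it. *)
Lemma horner_coef_le (R : realFieldType) (n : nat) (p : {poly R}) (x : R) :
  (size p <= n)%N ->
  `|p.[x]| <= (\sum_(i < n) `|x| ^+ i) * \sum_(i < n) `|p`_i|.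
Proof.
move=> sp; rewrite (horner_coef_wide _ sp) (le_trans (ler_norm_sum _ _ _)) //.
rewrite big_distrl /=; apply: ler_sum => i _; rewrite normrM normrX mulrC.
rewrite ler_wpM2l ?exprn_ge0 // (bigD1 i) //= lerDl.
by apply: sumr_ge0 => j _.
Qed.

Lemma horner_coef_le_unit (R : realFieldType) (n : nat) (p : {poly R}) (x : R) :
  (size p <= n)%N -> `|x| <= 1 -> `|p.[x]| <= n%:R * \sum_(i < n) `|p`_i|.
Proof.
move=> sp x1; apply: le_trans (horner_coef_le x sp) _.
rewrite ler_wpM2r ?sumr_ge0 //.
apply: (@le_trans _ _ (\sum_(i < n) 1)); last by rewrite sumr_const card_ord.
by apply: ler_sum => i _; rewrite exprn_ile1.
Qed.

Lemma ref_int_sqr_le (R : realType) (n : nat) (p : {poly R}) :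
  (size p <= n)%N ->
  ref_int (p * p) <= 2 * n%:R ^+ 3 * \sum_(i < n) p`_i ^+ 2.
Proof.
(* [c] bounds p^2 on [-1, 1]: n^2 comes from squaring [horner_coef_le_unit], one more n from
   [sqr_sum_le]. Written as the derivative of ['X * c%:P], it integrates to [2 * c]. *)
move=> sp; pose c := n%:R ^+ 3 * \sum_(i < n) p`_i ^+ 2.
have : 0 <= ref_int (('X * c%:P)^`() - p * p).
  apply: ref_int_ge0 => x x1; rewrite derivM derivX derivC mulr0 addr0 mul1r.
  rewrite hornerD hornerN hornerC hornerM -expr2 subr_ge0.
  have := horner_coef_le_unit sp; move/(_ x); rewrite ler_norml => /(_ x1) px.
  rewrite -real_normK ?num_real //.
  apply: le_trans (_ : (n%:R * \sum_(i < n) `|p`_i|) ^+ 2 <= _).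
    by rewrite lerXn2r // ?nnegrE // mulr_ge0 // sumr_ge0.
  rewrite exprMn /c (exprSr _ 2) -mulrA ler_wpM2l ?sqr_ge0 //.
  apply: le_trans (sqr_sum_le _) _; rewrite card_ord.
  by under eq_bigr do rewrite real_normK ?num_real //.
rewrite linearB /= ref_int_deriv !hornerM !hornerX !hornerC subr_ge0 => h.
have -> : 2 * n%:R ^+ 3 * \sum_(i < n) p`_i ^+ 2 = 2 * c by rewrite /c mulrA.
by apply: le_trans h _; move: c => c; lra.
Qed.

(* Each coefficient is integration against a dual polynomial, obtained by
   inverting the Gram matrix of the monomials. *)
Lemma coef_sqr_le_ref_int (R : realType) (n : nat) :
  exists2 C : R, 0 <= C & forall p : {poly R}, (size p <= n)%N ->
    \sum_(i < n) p`_i ^+ 2 <= C * ref_int (p * p).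
Proof.
pose G : 'M[R]_n := \matrix_(i, j) ref_int ('X^i * 'X^j).
pose pol (v : 'rV[R]_n) : {poly R} := \sum_i v 0 i *: 'X^i.
have polG v (j : 'I_n) : ref_int (pol v * 'X^j) = (v *m G) 0 j.
  rewrite mulr_suml linear_sum mxE; apply: eq_bigr => i _.
  by rewrite -scalerAl linearZ mxE.
have pol_coef v (j : 'I_n) : (pol v)`_j = v 0 j.
  rewrite coef_sum (bigD1 j) //= coefZ coefXn eqxx mulr1 big1 ?addr0 // => i ij.
  by rewrite coefZ coefXn eq_sym (inj_eq val_inj) (negPf ij) mulr0.
(* A vector in the kernel gives a polynomial whose square has zero integral, hence the zero
   polynomial. *)
have Gu : G \in unitmx.
  rewrite -row_free_unit; apply: inj_row_free => v vG.
  have : pol v == 0.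
    rewrite -ref_int_sqr_eq0 {2}/pol mulr_sumr linear_sum big1 // => j _.
    by rewrite -scalerAr linearZ /= polG vG mxE mulr0.
  by move/eqP => v0; apply/rowP => j; rewrite -pol_coef v0 coef0 mxE.
pose d i : {poly R} := \sum_j invmx G j i *: 'X^j.
(* These factors come from Cauchy-Schwarz against each dual polynomial. *)
exists (\sum_i ref_int (d i * d i)).
  by apply: sumr_ge0 => i _; exact: ref_int_sqr_ge0.
move=> p sp; rewrite mulr_suml; apply: ler_sum => i _; rewrite mulrC.
suff -> : p`_i = ref_int (p * d i) by exact: ref_int_cauchy_schwarz.
have pE : p = pol (\row_j p`_j).
  apply/polyP => k; have [kn|nk] := ltnP k n.
    by rewrite (pol_coef _ (Ordinal kn)) mxE.
  rewrite nth_default ?(leq_trans sp) // coef_sum big1 // => j _.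
  by rewrite coefZ coefXn gtn_eqF ?mulr0 // (leq_trans _ nk).
have -> : p`_i = ((\row_j p`_j) *m G *m invmx G) 0 i by rewrite mulmxK // mxE.
rewrite mxE [in RHS]/d mulr_sumr linear_sum; apply: eq_bigr => j _.
by rewrite -scalerAr linearZ /= [in RHS]pE polG mulrC.
Qed.

(** * L2 norms on a mesh *)

Lemma Rintegral_sum (d : measure_display) (T : measurableType d) (R : realType)
    (mu : {measure set T -> \bar R}) (D : set T) (I : Type) (s : seq I)
    (f : I -> T -> R) :
  measurable D -> (forall i, mu.-integrable D (EFin \o f i)) ->
  \int[mu]_(x in D) (\sum_(i <- s) f i x) = \sum_(i <- s) \int[mu]_(x in D) f i x.
Proof.
move=> mD intf; elim: s => [|i s IH].
  under eq_Rintegral do rewrite big_nil.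
  by rewrite big_nil Rintegral_cst // mul0r.
under eq_Rintegral do rewrite big_cons.
rewrite big_cons RintegralD ?IH //.
have -> : EFin \o (fun x => \sum_(j <- s) f j x) =
    (fun x => \sum_(j <- s) (EFin \o f j) x)%E.
  by apply/funext => x /=; rewrite sumEFin.
by apply: integrable_sum => // j _; exact: intf.
Qed.

Lemma integrable_horner_indic (R : realType) (u v s t : R) (p : {poly R}) :
  (@lebesgue_measure R).-integrable `[u, v]
    (EFin \o (fun x => p.[x] * \1_`[s, t[ x)).
Proof.
have -> : (fun x => p.[x] * \1_`[s, t[ x) = horner p \_ `[s, t[.
  by rewrite patch_indic.
rewrite -restrict_EFin; apply/integrable_restrict => //.
by apply: integrableS (integrable_horner u v p) => //; exact: measurableI.
Qed.

Lemma Rintegral_horner_indic (R : realType) (u v s t : R) (P : {poly R}) :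
  u <= s -> s <= t -> t <= v ->
  \int[@lebesgue_measure R]_(x in `[u, v]) ((P^`()).[x] * \1_`[s, t[ x) =
  P.[t] - P.[s].
Proof.
move=> us st tv.
have -> : (fun x => (P^`()).[x] * \1_`[s, t[ x) = horner P^`() \_ `[s, t[.
  by rewrite patch_indic.
rewrite -Rintegral_mkcondr (_ : `[u, v] `&` `[s, t[ = `[s, t[%classic); last first.
  apply/setIidr => x /=; rewrite !in_itv /= => /andP[sx xt].
  by rewrite (le_trans us sx) (ltW (lt_le_trans xt tv)).
rewrite Rintegral_itv_bndo_bndc ?Rintegral_deriv //.
apply: integrableS (integrable_horner s t P^`()) => //.
by apply: subset_itvl; rewrite bnd_simp.
Qed.

Section Mesh.
Variables (R : realType) (lo hi : R) (K : nat).
Hypotheses (lohi : lo < hi) (K0 : (0 < K)%N).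
Let h := mesh_size lo hi K.

Lemma mesh_size_gt0 : 0 < mesh_size lo hi K.
Proof. by rewrite divr_gt0 ?subr_gt0 ?ltr0n. Qed.

Lemma mesh_nodeS (k : nat) :
  mesh_node lo hi K k.+1 = mesh_node lo hi K k + mesh_size lo hi K.
Proof. by rewrite /mesh_node -natr1 mulrDl mul1r addrA. Qed.

Lemma mesh_node_le (j k : nat) : (j <= k)%N ->
  mesh_node lo hi K j <= mesh_node lo hi K k.
Proof.
by move=> jk; rewrite lerD2l ler_wpM2r ?ler_nat // ltW // mesh_size_gt0.
Qed.

Lemma mesh_node_itv (k : nat) : (k <= K)%N -> lo <= mesh_node lo hi K k <= hi.
Proof.
move=> kK; apply/andP; split.
  by rewrite lerDl mulr_ge0 // ltW // mesh_size_gt0.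
apply: le_trans (mesh_node_le kK) _.
by rewrite /mesh_node /mesh_size mulrC divfK ?subrKC // pnatr_eq0 -lt0n.
Qed.

Lemma ref_coord_itv (k : nat) (x : R) :
  mesh_node lo hi K k <= x <= mesh_node lo hi K k.+1 ->
  `|ref_coord lo hi K k x| <= 1.
Proof.
have h0 := mesh_size_gt0; rewrite /ref_coord mesh_nodeS.
rewrite [_ + _ - _]addrAC subrr add0r => /andP[kx xk]; rewrite ler_norml.
apply/andP; split.
  by rewrite lerBrDr addNr divr_ge0 ?mulr_ge0 ?subr_ge0 // ltW.
by rewrite lerBlDr ler_pdivrMr //; lra.
Qed.

(** The half-open elements are disjoint, so at most one term is nonzero at [x] and no cross products
    arise. *)
Lemma dg_fun_sqr (W : 'I_K -> {poly R}) (x : R) :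
  dg_fun lo hi W x ^+ 2 =
  \sum_(k < K) (W k * W k).[ref_coord lo hi K k x]
    * \1_`[mesh_node lo hi K k, mesh_node lo hi K k.+1[ x.
Proof.
have [[k xk]|nk] := pselect (exists k : 'I_K,
    x \in `[mesh_node lo hi K k, mesh_node lo hi K k.+1[).
  have off (j : 'I_K) : j != k ->
      \1_`[mesh_node lo hi K j, mesh_node lo hi K j.+1[ x = 0 :> R.
    move=> jk; rewrite indicE; case: (boolP (_ \in _)) => //.
    move: xk; rewrite inE /= !in_itv /= => /andP[kx xk] /andP[jx xj].
    case: (ltngtP j k) => [jlk|klj|/val_inj jek]; last by rewrite jek eqxx in jk.
    - by have := lt_le_trans xj (mesh_node_le jlk); rewrite ltNge kx.
    - by have := lt_le_trans xk (mesh_node_le klj); rewrite ltNge jx.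
  rewrite /dg_fun [in LHS](bigD1 k) //= [in RHS](bigD1 k) //=.
  rewrite [in LHS]big1 => [|j jk]; last by rewrite off ?mulr0.
  rewrite [in RHS]big1 => [|j jk]; last by rewrite off ?mulr0.
  rewrite !addr0.
  by rewrite indicE mem_set // !mulr1 hornerM expr2.
have off (j : 'I_K) :
    \1_`[mesh_node lo hi K j, mesh_node lo hi K j.+1[ x = 0 :> R.
  rewrite indicE; case: (boolP (_ \in _)) => //; rewrite inE => xj.
  by case: nk; exists j.
by rewrite /dg_fun !big1 ?expr0n // => j _; rewrite off mulr0.
Qed.

Lemma L2norm_dg_fun (W : 'I_K -> {poly R}) :
  L2norm lo hi (dg_fun lo hi W) ^+ 2 =
  mesh_size lo hi K / 2 * \sum_(k < K) ref_int (W k * W k).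
Proof.
have h0 := mesh_size_gt0.
rewrite /L2norm sqr_sqrtr; last by apply: Rintegral_ge0 => x _; exact: sqr_ge0.
under eq_Rintegral do rewrite dg_fun_sqr.
(* With [ref_coord] as a polynomial, the change of variables is the chain rule for primitives; the
   slope [2 / h] gives the Jacobian [h / 2]. *)
pose A k : {poly R} := (2 / h) *: ('X - (mesh_node lo hi K k)%:P) - 1%:P.
have AE k x : (A k).[x] = ref_coord lo hi K k x.
  rewrite /A /ref_coord mesh_nodeS [mesh_node _ _ _ _ + _ - _]addrAC subrr add0r.
  by rewrite !hornerE mulrAC.
have A' k : (A k)^`() = (2 / h)%:P.
  by rewrite /A derivB derivC subr0 derivZ derivXsubC alg_polyC.
have term (k : nat) (p : {poly R}) : (k < K)%N ->
  \int[@lebesgue_measure R]_(x in `[lo, hi]) (p.[ref_coord lo hi K k x]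
    * \1_`[mesh_node lo hi K k, mesh_node lo hi K k.+1[ x) = h / 2 * ref_int p.
  move=> kK; have [P ->] := poly_antideriv p.
  under eq_Rintegral => x _.
    rewrite -AE -horner_comp.
    have -> : P^`() \Po A k = ((h / 2) *: (P \Po A k))^`().
      rewrite derivZ deriv_comp A' [_ * _%:P]mulrC mul_polyC scalerA.
      by rewrite -[h / 2]invf_div mulVf ?scale1r // gt_eqF // divr_gt0.
    over.
  have /andP[lok _] := mesh_node_itv (ltnW kK).
  have /andP[_ khi] := mesh_node_itv kK.
  rewrite Rintegral_horner_indic ?mesh_node_le // !hornerZ !horner_comp !AE.
  rewrite ref_int_deriv mulrBr /ref_coord mesh_nodeS.
  rewrite [mesh_node _ _ _ _ + _ - _]addrAC subrr add0r mulr0 mul0r sub0r mulfK ?gt_eqF //.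
  by rewrite (_ : 2 - 1 = 1) //; ring.
rewrite Rintegral_sum //.
  by rewrite mulr_sumr; apply: eq_bigr => k _; rewrite term.
move=> k.
  have -> : (fun x => (W k * W k).[ref_coord lo hi K k x]
    * \1_`[mesh_node lo hi K k, mesh_node lo hi K k.+1[ x) =
    (fun x => ((W k * W k) \Po A k).[x]
    * \1_`[mesh_node lo hi K k, mesh_node lo hi K k.+1[ x).
    by apply/funext => x; rewrite horner_comp AE.
  exact: integrable_horner_indic.
Qed.
End Mesh.

(** * Energy bounds *)

(** Gronwall's argument: the sum of squares [E] satisfies E' <= L E, so exp(-L t) E is
    nonincreasing. *)
Lemma linear_growth_bound (R : realType) (J : finType) (y : J -> R -> R)
    (C T : R) :
  0 <= C -> 0 <= T ->
  (forall j, {within `[0, T], continuous (y j)}) ->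
  (forall j (t : R), t \in `]0, T[ -> derivable (y j) t 1) ->
  (forall j (t : R), t \in `]0, T[ ->
    `|derive1 (y j) t| <= C * \sum_i `|y i t|) ->
  \sum_j y j T ^+ 2 <= expR (2 * C * #|J|%:R * T) * \sum_j y j 0 ^+ 2.
Proof.
move=> C0 T0 cy dy ygrowth.
(* The 2 comes from differentiating squares, [#|J|] from [sqr_sum_le]. *)
pose L := 2 * C * #|J|%:R.
pose E : R -> R := \sum_j (y j ^+ 2).
have EE t : E t = \sum_j y j t ^+ 2.
  by rewrite /E fct_sumE; apply: eq_bigr => j _; rewrite expr2.
pose e : R -> R := expR \o (fun t => - L * t).
have dE (t : R) : t \in `]0, T[ ->
    is_derive t 1 E (\sum_j (2%:R * y j t ^+ 1) *: derive1 (y j) t).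
  move=> t0T; rewrite /E; elim/big_ind2 : _ => [|f1 d1 f2 d2 ? ?|j _].
  - exact: is_derive_cst.
  - exact: is_deriveD.
  - by apply: is_deriveX; rewrite derive1E; apply/derivableP; exact: dy.
have de (t : R) : is_derive t 1 e (expR (- L * t) * (- L)).
  apply: is_derive1_comp.
  have := @is_deriveZ _ _ _ id (- L) t 1 1 (is_derive_id _ _).
  by rewrite -[_ *: 1]/(_ * 1) mulr1.
have dF (t : R) : t \in `]0, T[ -> is_derive t 1 (e * E)
   (e t *: (\sum_j (2%:R * y j t ^+ 1) *: derive1 (y j) t) +
    E t *: (expR (- L * t) * (- L))).
  by move=> t0T; have := dE _ t0T => ?; exact: is_deriveM.
(* The derivative is controlled on the open interval; continuity carries monotonicity to the
   endpoints. *)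
have nonincr : {in `[0, T] &, {homo (e * E) : s t /~ s <= t}}.
  apply: ler0_derive1_le_cc.
  - by move=> t t0T; have [] := dF _ t0T.
  - move=> t t0T; rewrite derive1E (@derive_val _ _ _ _ _ _ _ (dF _ t0T)).
    rewrite /= -/(e t) -[_ *: _]/(_ * _) -[E t *: _]/(_ * _).
    rewrite mulrCA -mulrDr pmulr_rle0 ?expR_gt0 // mulrN subr_le0.
    have Sq := sqr_sum_le (fun i => `|y i t|).
    apply: (@le_trans _ _ (2 * C * (\sum_i `|y i t|) ^+ 2)); last first.
      have -> : E t * L = 2 * C * (#|J|%:R * E t) by rewrite /L; ring.
      rewrite ler_wpM2l ?mulr_ge0 // (le_trans Sq) // ler_wpM2l // EE.
      by apply: ler_sum => i _; rewrite real_normK ?num_real.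
    rewrite expr2 mulrA mulr_sumr; apply: ler_sum => i _.
    rewrite expr1 -[_ *: _]/(_ * _) (le_trans (ler_norm _)) // !normrM.
    rewrite ger0_norm // mulrC -mulrA [2 * _]mulrC.
    have := ygrowth i t t0T; set d := `|_|; set s := \sum_i _ => ds.
    rewrite -/s.
    have y0 := normr_ge0 (y i t); move: ds y0; move: d s `|_| => d s z; nra.
  - move=> t; apply: cvgM.
      apply: continuous_subspaceT => s; apply: differentiable_continuous.
      by apply/derivable1_diffP; have [] := de s.
    rewrite /E; elim/big_ind : _ => [|f g cf cg|j _]; first exact: cvg_cst.
    + exact: cvgD.
    + by rewrite expr2; apply: cvgM; exact: cy.
have := nonincr T 0; rewrite !in_itv /= !lexx T0 => /(_ isT isT isT).
rewrite /e /= -![(_ * _) _]/(_ * _) /= mulr0 expR0 mul1r -!EE => h.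
have := ler_wpM2l (expR_ge0 (L * T)) h.
by rewrite mulrA -expRD mulNr subrr expR0 mul1r.
Qed.

Lemma L2norm_dg_fun_equiv (R : realType) (lo hi : R) (K n : nat) :
  lo < hi -> (0 < K)%N ->
  exists2 C : R, 0 <= C & forall W : 'I_K -> {poly R},
    (forall k, (size (W k) <= n)%N) ->
    L2norm lo hi (dg_fun lo hi W) ^+ 2
      <= C * \sum_(k < K) \sum_(i < n) (W k)`_i ^+ 2 /\
    \sum_(k < K) \sum_(i < n) (W k)`_i ^+ 2
      <= C * L2norm lo hi (dg_fun lo hi W) ^+ 2.
Proof.
move=> lohi K0; have [B B0 lower] := coef_sqr_le_ref_int R n.
have [h hE h0] : exists2 h, h = mesh_size lo hi K & 0 < h.
  by exists (mesh_size lo hi K) => //; exact: mesh_size_gt0.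
(* [A] bounds the squared norm by the coefficients, [D] the coefficients by the squared norm; their
   sum serves both directions. *)
pose A : R := h / 2 * (2 * n%:R ^+ 3); pose D := B * (2 / h).
have A0 : 0 <= A.
  by apply: mulr_ge0; [apply: divr_ge0; rewrite ?ltW
                      | apply: mulr_ge0; rewrite ?exprn_ge0].
have D0 : 0 <= D by apply: mulr_ge0 => //; apply: divr_ge0; rewrite ?ltW.
exists (A + D) => [|W sW]; first exact: addr_ge0.
have S0 : 0 <= \sum_(k < K) \sum_(i < n) (W k)`_i ^+ 2.
  by apply: sumr_ge0 => k _; apply: sumr_ge0 => i _; exact: sqr_ge0.
split; rewrite mulrDl.
- apply: (@le_trans _ _ (A * \sum_(k < K) \sum_(i < n) (W k)`_i ^+ 2)); last first.
    by rewrite lerDl mulr_ge0.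
  rewrite L2norm_dg_fun // -hE /A -(mulrA (h / 2)) ler_wpM2l //; first by rewrite divr_ge0 // ltW.
  by rewrite mulr_sumr; apply: ler_sum => k _; exact: ref_int_sqr_le.
- apply: (@le_trans _ _ (D * L2norm lo hi (dg_fun lo hi W) ^+ 2)); last first.
    by rewrite lerDr mulr_ge0 // sqr_ge0.
  rewrite L2norm_dg_fun // -hE /D -(mulrA B) (mulrA (2 / h)).
  have -> : 2 / h * (h / 2) = 1.
    by rewrite -[h / 2]invf_div mulfV // gt_eqF // divr_gt0.
  by rewrite mul1r mulr_sumr; apply: ler_sum => k _; exact: lower.
Qed.

(** The external state stays a separate term, so the bound serves both the base grid, where it is
    zero, and the overset grid, where it comes from [U]. The constant precedes [omega0] and [W],
    hence is independent of the data. *)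
Lemma dgsem_rate (R : realType) (N K : nat) (xi w : 'I_N.+1 -> R)
    (alpha lo hi T : R) :
  0 < alpha -> lo < hi -> (0 < K)%N -> (0 < N)%N -> is_LGL xi w ->
  exists2 C : R, 0 <= C &
    forall (ext omega0 : R -> R) (W : R -> 'I_K -> {poly R}),
    dgsem_solution xi w alpha lo hi T ext omega0 W ->
    forall (t : R) (k : 'I_K) (i : 'I_N.+1), t \in `]0, T[ ->
    `|derive1 (fun s => (W s k)`_i) t|
      <= C * (`|ext t| + \sum_(k < K) \sum_(i < N.+1) `|(W t k)`_i|).
Proof.
move=> alpha0 lohi K0 N0 lgl.
have xi_inj := LGL_injective lgl; have w0 j := LGL_weight_gt0 j N0 lgl.
have [h hE h0] : exists2 h, h = mesh_size lo hi K & 0 < h.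
  by exists (mesh_size lo hi K) => //; exact: mesh_size_gt0.
pose l := lagrange_basis xi.
(* [D j] bounds the volume term tested with [l j]; [B j] adds the fluxes at both ends and divides by
   the mass factor [h / 2 * w j]. *)
pose D j := \sum_i (\sum_(m < N.+1) `|xi i| ^+ m) * `|(l j)^`().[xi i]| * w i.
pose B j := (alpha * D j + alpha * N.+1%:R * `|(l j).[1]|
  + alpha * N.+1%:R * `|(l j).[-1]|) / (h / 2 * w j).
have a0 := ltW alpha0.
have D0 j : 0 <= D j.
  apply: sumr_ge0 => i _; rewrite !mulr_ge0 // ?(ltW (w0 i)) //.
  by apply: sumr_ge0 => m _; exact: exprn_ge0.
have hw j : 0 < h / 2 * w j by rewrite mulr_gt0 ?divr_gt0.
have B0 j : 0 <= B j.
  by rewrite divr_ge0 ?(ltW (hw j)) // !addr_ge0 ?mulr_ge0.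
exists (\sum_(i < N.+1) \sum_j B j * `|(l j)`_i|).
  by apply: sumr_ge0 => i _; apply: sumr_ge0 => j _; exact: mulr_ge0.
move=> ext omega0 W [sW cW dW eqW initW] t k i t0T.
set X := _ + _.
have tT : t \in `[0, T] by exact: subset_itv_oo_cc.
have sumk k' : \sum_(i < N.+1) `|(W t k')`_i| <= X.
  apply: (@le_trans _ _ (\sum_(k < K) \sum_(i < N.+1) `|(W t k)`_i|));
    last by rewrite lerDr.
  rewrite (bigD1 k') //= lerDl; apply: sumr_ge0 => m _; exact: sumr_ge0.
have X0 : 0 <= X by apply: le_trans (sumk k); exact: sumr_ge0.
have trace k' x : `|x| <= 1 -> `|(W t k').[x]| <= N.+1%:R * X.
  move=> x1; apply: le_trans (horner_coef_le_unit (sW t k' tT) x1) _.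
  by rewrite ler_wpM2l.
(* The inflow state is the external one or a neighbour's trace at 1; since [N.+1] is at least 1, one
   bound covers both. *)
have left_le : `|left_state (ext t) (W t) k| <= N.+1%:R * X.
  rewrite /left_state; case: ifP => _; last by rewrite trace ?normr1.
  apply: (@le_trans _ _ X); last by rewrite ler_peMl // ler1n.
  rewrite lerDl; apply: sumr_ge0 => m _; exact: sumr_ge0.
set P := poly_dt N (fun s => W s k) t.
have node j : `|P.[xi j]| <= B j * X.
  have := eqW t k (l j) t0T (size_lagrange_basis _ _).
  rewrite /dg_residual /upwind_flux -/P -hE {1}/lgl_ip (bigD1 j) //=.
  rewrite big1 => [|m mj]; last first.
    by rewrite horner_lagrange_basis // (negPf mj) mulr0 mul0r.
  rewrite horner_lagrange_basis // eqxx mulr1 addr0.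
  set G := lgl_ip _ _ _ _; set a := (l j).[1] * _; set b := (l j).[-1] * _ => e.
  have PE : P.[xi j] * (h / 2 * w j) = alpha * G - a + b by lra.
  rewrite /B mulrAC ler_pdivlMr // -[X in _ * X](gtr0_norm (hw j)) -normrM PE.
  apply: le_trans (ler_normD _ _) _; rewrite !mulrDl lerD //; last first.
    rewrite /b !normrM (gtr0_norm alpha0) mulrCA -!mulrA.
    by rewrite ler_wpM2l // [leRHS]mulrCA ler_wpM2l.
  apply: le_trans (ler_normD _ _) _; rewrite normrN lerD //; last first.
    rewrite /a !normrM (gtr0_norm alpha0) mulrCA -!mulrA ler_wpM2l //.
    by rewrite [leRHS]mulrCA ler_wpM2l // trace ?normr1.
  rewrite normrM (gtr0_norm alpha0) -mulrA ler_wpM2l //.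
  apply: le_trans (ler_norm_sum _ _ _) _; rewrite mulr_suml; apply: ler_sum => m _.
  rewrite !normrM (gtr0_norm (w0 m)) [leRHS]mulrAC ler_wpM2r ?(ltW (w0 m)) //.
  rewrite [leRHS]mulrAC ler_wpM2r //; apply: le_trans (horner_coef_le _ (sW t k tT)) _.
  by rewrite ler_wpM2l // sumr_ge0 // => q _; exact: exprn_ge0.
have -> : derive1 (fun s => (W s k)`_i) t = P`_i by rewrite coef_poly ltn_ord.
have sP : (size P <= N.+1)%N by exact: size_poly.
(* Interpolation passes from nodal rates back to coefficient rates. *)
rewrite (lagrange_interpolation xi_inj sP) coef_sum.
apply: le_trans (ler_norm_sum _ _ _) _.
apply: (@le_trans _ _ (\sum_j B j * `|(l j)`_i| * X)).
  by apply: ler_sum => j _; rewrite coefZ normrM mulrAC ler_wpM2r.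
rewrite -mulr_suml ler_wpM2r // [leRHS](bigD1 i) //= lerDl.
by apply: sumr_ge0 => m _; apply: sumr_ge0 => j _; exact: mulr_ge0.
Qed.

Theorem theorem1 (R : realType) (alpha a b c d T : R) (N Ku Kv : nat)
    (xi w : 'I_N.+1 -> R)
    (halpha : 0 < alpha) (hab : a < b) (hbc : b < c) (hcd : c < d)
    (hN : (0 < N)%N) (hKu : (0 < Ku)%N) (hKv : (0 < Kv)%N) (hT : 0 <= T)
    (hLGL : is_LGL xi w) :
  exists K : R,
    forall (kb : 'I_Ku) (omega0 : R -> R)
      (U : R -> 'I_Ku -> {poly R}) (V : R -> 'I_Kv -> {poly R}),
      b \in `[mesh_node a c Ku kb, mesh_node a c Ku kb.+1] ->
      overset_solution xi w alpha a b c d T kb omega0 U V ->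
      L2norm a c (dg_fun a c (U T)) ^+ 2 + L2norm b d (dg_fun b d (V T)) ^+ 2
      <= K * (L2norm a c (dg_fun a c (U 0)) ^+ 2
              + L2norm b d (dg_fun b d (V 0)) ^+ 2).
Proof.
have hac := lt_trans hab hbc; have hbd := lt_trans hbc hcd.
have [Cu Cu0 rateU] := dgsem_rate T halpha hac hKu hN hLGL.
have [Cv Cv0 rateV] := dgsem_rate T halpha hbd hKv hN hLGL.
have [Du Du0 eqvU] := L2norm_dg_fun_equiv N.+1 hac hKu.
have [Dv Dv0 eqvV] := L2norm_dg_fun_equiv N.+1 hbd hKv.
(* The coefficients of both grids form one family, to which Gronwall applies at once. In [C], the
   factor [N.+1] on [Cv] pays for the external state of [V], a point value of [U]. *)
pose J := ('I_Ku * 'I_N.+1 + 'I_Kv * 'I_N.+1)%type.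
pose C := Cu + Cv * N.+1%:R.
pose M := expR (2 * C * #|{: J}|%:R * T).
(* The outer factors are the norm equivalences at times [T] and [0]; [M] is the growth of the
   coefficients in between. *)
exists ((Du + Dv) * (M * (Du + Dv))) => kb omega0 U V hb [solU solV].
pose y (j : J) (t : R) : R :=
  match j with
  | inl ki => (U t ki.1)`_ki.2
  | inr ki => (V t ki.1)`_ki.2
  end.
have sumJ (f : R -> R) t : \sum_j f (y j t) =
    \sum_(k < Ku) \sum_(i < N.+1) f (U t k)`_i +
    \sum_(k < Kv) \sum_(i < N.+1) f (V t k)`_i.
  by rewrite big_sumType /= !pair_bigA.
have [sU cU dU _ _] := solU; have [sV cV dV _ _] := solV.
have oo_cc t : t \in `]0, T[ -> t \in `[0, T] by exact: subset_itv_oo_cc.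
have C0 : 0 <= C by rewrite addr_ge0 // mulr_ge0.
have growth : \sum_j y j T ^+ 2 <= M * \sum_j y j 0 ^+ 2.
  apply: linear_growth_bound => //.
  - by case=> ki; [exact: cU | exact: cV].
  - by case=> ki t t0T; [exact: dU | exact: dV].
  move=> j t t0T; rewrite (sumJ (fun x => `|x|)).
  set SU := \sum_(k < Ku) _; set SV := \sum_(k < Kv) _.
  have SU0 : 0 <= SU by apply: sumr_ge0 => k _; exact: sumr_ge0.
  have SV0 : 0 <= SV by apply: sumr_ge0 => k _; exact: sumr_ge0.
  have N1 : 1 <= N.+1%:R :> R by rewrite ler1n.
  case: j => ki.
  - apply: le_trans (rateU _ _ _ solU t ki.1 ki.2 t0T) _.
    rewrite normr0 add0r -/SU; apply: ler_pM => //; last by rewrite lerDl.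
    by rewrite lerDl mulr_ge0.
  - apply: le_trans (rateV _ _ _ solV t ki.1 ki.2 t0T) _.
    rewrite -/SV; apply: (@le_trans _ _ (Cv * (N.+1%:R * (SU + SV)))); last first.
      by rewrite mulrA ler_wpM2r ?addr_ge0 // lerDr.
    rewrite ler_wpM2l // mulrDr lerD //; last by rewrite ler_peMl.
    (* [b] lies in the closed element [kb], so its reference coordinate is in [-1, 1], even when [b]
       is an interface. *)
    have hb1 : `|ref_coord a c Ku kb b| <= 1.
      by apply: ref_coord_itv => //; move: hb; rewrite in_itv.
    apply: le_trans (horner_coef_le_unit (sU t kb (oo_cc _ t0T)) hb1) _.
    rewrite ler_wpM2l // /SU (bigD1 kb) //= lerDl.
    by apply: sumr_ge0 => k _; exact: sumr_ge0.
move: growth; rewrite !(sumJ (fun x => x ^+ 2)).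
have T0 : 0 \in `[0, T] by rewrite in_itv /= lexx.
have TT : T \in `[0, T] by rewrite in_itv /= lexx andbT.
have [uT _] := eqvU (U T) (fun k => sU T k TT).
have [_ u0] := eqvU (U 0) (fun k => sU 0 k T0).
have [vT _] := eqvV (V T) (fun k => sV T k TT).
have [_ v0] := eqvV (V 0) (fun k => sV 0 k T0).
move: uT u0 vT v0.
have sq_ge0 (K : nat) (W : 'I_K -> {poly R}) :
    0 <= \sum_(k < K) \sum_(i < N.+1) (W k)`_i ^+ 2.
  by apply: sumr_ge0 => k _; apply: sumr_ge0 => i _; exact: sqr_ge0.
have := (sq_ge0 _ (U T), sq_ge0 _ (V T)).
set EUT := \sum_(k < Ku) _; set EVT := \sum_(k < Kv) _.
set EU0 := \sum_(k < Ku) _; set EV0 := \sum_(k < Kv) _.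
set nU0 := L2norm a c (dg_fun a c (U 0)) ^+ 2.
set nV0 := L2norm b d (dg_fun b d (V 0)) ^+ 2.
have nU0_ge0 : 0 <= nU0 by exact: sqr_ge0.
have nV0_ge0 : 0 <= nV0 by exact: sqr_ge0.
move=> [EUT0 EVT0] uT u0 vT v0 growth.
apply: (@le_trans _ _ ((Du + Dv) * (EUT + EVT))); first by nra.
rewrite -mulrA ler_wpM2l ?addr_ge0 // (le_trans growth) // -mulrA.
by rewrite ler_wpM2l ?expR_ge0 //; nra.
Qed.
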